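(* Let $T$ be a tree of order $n$ with diameter $d(T)>3$. Then $$\lambda_1(A(P_n^c))\le \lambda_1(A(T^c))\le \lambda_1(A(T^c(n-3,1))).$$ The left equality holds if and only if $T\cong P_n$, and the right equality holds if and only if $T\cong T(n-3,1)$.
   Context: For a graph $G$, $G^c$ denotes its complement, $A(G)$ its adjacency matrix and $\lambda_1(A(G))$ the largest eigenvalue of $A(G)$. $P_n$ is the path on $n$ vertices. $T(n-3,1)$ is the tree obtained from the path $P_3$ by attaching $n-3$ new pendant vertices to one end vertex of $P_3$, and $T^c(n-3,1)$ is its complement. *)

(* Defs.v *)
From mathcomp Require Import all_boot all_order all_algebra.
From mathcomp Require Import spectral complex polyrcf.
From mathcomp Require Import boolp classical_sets reals.

Set Implicit Arguments.
Unset Strict Implicit.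
Unset Printing Implicit Defensive.

Import Order.TTheory GRing.Theory Num.Theory.
Local Open Scope ring_scope.

Record sgraph := SGraph {
  vertex :> finType;
  adj : rel vertex;
  adj_sym : symmetric adj;
  adj_irr : irreflexive adj }.
Arguments adj {_} _ _.

Definition isomorphic (G H : sgraph) : Prop :=
  exists2 f : G -> H, bijective f & forall x y, adj (f x) (f y) = adj x y.

Section Complement.
Variable G : sgraph.

Definition compl_adj (x y : G) := (x != y) && ~~ adj x y.

Fact compl_adj_sym : symmetric compl_adj.
Proof. by move=> x y; rewrite /compl_adj eq_sym adj_sym. Qed.

Fact compl_adj_irr : irreflexive compl_adj.
Proof. by move=> x; rewrite /compl_adj eqxx. Qed.

Definition complement : sgraph := SGraph compl_adj_sym compl_adj_irr.
End Complement.

Section PathGraph.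
Variable n : nat.

Definition path_adj (i j : 'I_n) := (i.+1 == j :> nat) || (j.+1 == i :> nat).

Fact path_adj_sym : symmetric path_adj.
Proof. by move=> i j; rewrite /path_adj orbC. Qed.

Fact path_adj_irr : irreflexive path_adj.
Proof. by move=> i; rewrite /path_adj orbb gtn_eqF. Qed.

Definition path_graph : sgraph := SGraph path_adj_sym path_adj_irr.
End PathGraph.

Section Pendants.
Variables (G : sgraph) (v : G) (k : nat).

Definition pendant_adj (x y : G + 'I_k) : bool :=
  match x, y with
  | inl a, inl b => adj a b
  | inl a, inr _ => a == v
  | inr _, inl b => b == v
  | inr _, inr _ => false
  end.

Fact pendant_adj_sym : symmetric pendant_adj.
Proof. by move=> [a|i] [b|j] //=; rewrite adj_sym. Qed.

Fact pendant_adj_irr : irreflexive pendant_adj.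
Proof. by move=> [a|i] //=; rewrite adj_irr. Qed.

Definition attach_pendants : sgraph := SGraph pendant_adj_sym pendant_adj_irr.
End Pendants.

(* The tree T(k, 1), of order k + 3; ord0 is an end vertex of the path P_3. *)
Definition T_1 (k : nat) : sgraph := @attach_pendants (path_graph 3) ord0 k.

Section Trees.
Variable G : sgraph.

Definition connected : Prop := (0 < #|G|)%N /\ forall x y : G, connect adj x y.

(* A cycle of a simple graph has at least three vertices; [:: x; y] with x
   adjacent to y also satisfies ucycle. *)
Definition acyclic : Prop :=
  forall c : seq G, ucycle adj c -> (size c < 3)%N.

Definition is_tree : Prop := connected /\ acyclic.

Definition walk_of_length (k : nat) (x y : G) : bool :=
  [exists p : k.-tuple G, path adj x p && (last x p == y)].

(* The least length of a walk from x to y; the value is #|G| when there is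
   none, since a shortest walk has length less than #|G|. *)
Definition dist (x y : G) : nat :=
  find (fun k => walk_of_length k x y) (iota 0 #|G|).

Definition diameter : nat := \max_(x : G) \max_(y : G) dist x y.

Lemma dist_min (x y : G) (p : seq G) :
  path adj x p -> last x p = y -> (dist x y <= size p)%N.
Proof.
move=> Hp Hl; rewrite leqNgt; apply/negP => lt_p.
have szp : (size p < #|G|)%N.
  by apply: leq_trans lt_p _; rewrite -[X in (_ <= X)%N](size_iota 0) find_size.
have := @before_find _ 0%N (fun k => walk_of_length k x y) (iota 0 #|G|) _ lt_p.
rewrite nth_iota // add0n => /existsP[]; exists (in_tuple p).
by rewrite Hp Hl eqxx.
Qed.

Lemma dist_path (x y : G) : connect adj x y ->
  exists p, [/\ path adj x p, last x p = y & size p = dist x y].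
Proof.
case/connectP=> p0 /shortenP[p Hp Up _] Hy.
have szp : (size p < #|G|)%N by have := max_card (mem (x :: p)); rewrite (card_uniqP Up).
have Hf : has (fun k => walk_of_length k x y) (iota 0 #|G|).
  apply/hasP; exists (size p); first by rewrite mem_iota.
  by apply/existsP; exists (in_tuple p); rewrite Hp -Hy eqxx.
have /existsP[q /andP[Hq /eqP Hqy]] := nth_find 0%N Hf.
exists q; split=> //; rewrite size_tuple nth_iota //.
by rewrite -[X in (_ < X)%N](size_iota 0) -has_find.
Qed.
End Trees.

Section Spectrum.
Variable R : realType.

Definition adjacency (G : sgraph) : 'M[R]_#|G| :=
  \matrix_(i, j) (adj (enum_val i) (enum_val j))%:R.

Lemma adjacency_tr (G : sgraph) : (adjacency G)^T = adjacency G.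
Proof. by apply/matrixP => i j; rewrite !mxE adj_sym. Qed.

(* See lambda1_max: for a symmetric real matrix this is the maximum. *)
Definition lambda1 n (A : 'M[R]_n) : R :=
  sup [set a : R | eigenvalue A a]%classic.

Lemma sym_eigenvalue n (A : 'M[R]_n) :
  (0 < n)%N -> A^T = A -> exists a, eigenvalue A a.
Proof.
move=> n_gt0 symA; pose B := map_mx (real_complex R) A.
have [a aB] := eigenvalue_closed B n_gt0.
suff [r ra] : exists r : R, a = real_complex R r.
  exists r; move: aB; rewrite ra !eigenvalue_root_char.
  by rewrite -map_char_poly fmorph_root.
have /eigenvalueP[v vB v0] := aB.
have BH : map_mx Num.conj B^T = B.
  apply/matrixP => i j; rewrite !mxE -{2}symA mxE.
  by apply/CrealP; rewrite complex_real.
have eqa : v *m B *m map_mx Num.conj v^T = a *: (v *m map_mx Num.conj v^T).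
  by rewrite vB scalemxAl.
have := congr1 (fun M => map_mx Num.conj M^T) eqa.
rewrite !trmx_mul !map_mxM BH /=.
have vK : map_mx Num.conj (map_mx Num.conj v^T)^T = v.
  by apply/matrixP => i j; rewrite !mxE conjCK.
rewrite vK mulmxA eqa linearZ /= map_mxZ trmx_mul map_mxM vK.
set d := v *m _ => eqd.
have d0 : d 0 0 != 0.
  rewrite mxE; apply: contraNneq v0 => s0; apply/eqP/rowP => j.
  have := psumr_eq0P _ s0 => /(_ _ j isT); rewrite !mxE => H.
  apply/eqP; rewrite -normr_eq0 -sqrf_eq0 normCK H // => i _.
  by rewrite !mxE -normCK exprn_ge0.
have := congr1 (fun M : 'M_1 => M 0 0) eqd.
rewrite /= [LHS]mxE [RHS]mxE => /(mulIf d0) eq_a.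
have aR : a \is Num.real by apply/CrealP.
by have /complex_realP[r ar] := aR; exists r.
Qed.

Lemma lambda1_max n (A : 'M[R]_n) : (0 < n)%N -> A^T = A ->
  eigenvalue A (lambda1 A) /\ forall a, eigenvalue A a -> a <= lambda1 A.
Proof.
move=> n_gt0 symA.
have [a0 a0A] := sym_eigenvalue n_gt0 symA.
have p0 : char_poly A != 0 by rewrite monic_neq0 // char_poly_monic.
have memr a : eigenvalue A a = (a \in rootsR (char_poly A)).
  rewrite eigenvalue_root_char.
  by have /(_ a) := roots_on_rootsR p0; rewrite in_itv.
have [m mA mmax] : exists2 m, eigenvalue A m & forall a, eigenvalue A a -> a <= m.
  exists (\big[Num.max/a0]_(a <- rootsR (char_poly A)) a).
    rewrite big_seq; elim/big_ind: _ => // [x y Hx Hy|x].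
      by case: (leP x y).
    by rewrite memr.
  by move=> a; rewrite memr => /le_bigmax_seq; apply.
suff -> : lambda1 A = m by [].
apply/eqP; rewrite eq_le; apply/andP; split.
  by apply: ge_sup; [exists m | exact: mmax].
by apply: ub_le_sup => //; exists m; exact: mmax.
Qed.
End Spectrum.

(* Main.v *)
(* The complement of G has adjacency matrix J - I - A(G), so for a vector x its
   quadratic form is (sum x)^2 - |x|^2 - 2 sum_(uv in E(G)) x_u x_v, and lambda_1
   is its maximum on the unit sphere.

   Upper bound. Let x be a positive eigenvector of the complement of T for
   lambda_1, root T at a vertex z where x is minimal, and let c have parent
   b <> z. Re-attaching every vertex but c to z can only decrease the sum over the
   edges and gives a copy of T(n-3,1). Equality would make x an eigenvector of
   both complements; comparing the rows at z, every vertex but c is then adjacent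
   to z in T, so T has diameter at most 3. Thus the inequality is always strict.

   Lower bound. A tree that is not a path has three leaves. The test vector equal
   to 1 + 1/(n-2) on them and to 1 elsewhere bounds lambda_1 of its complement
   from below; a positive vector y with A y <= m y bounds lambda_1 of the
   complement of the path by m; and m is below the former bound. *)

Require Import Defs.
From mathcomp Require Import all_boot all_order all_algebra.
From mathcomp Require Import spectral complex boolp reals ring lra zify.

Set Implicit Arguments.
Unset Strict Implicit.
Unset Printing Implicit Defensive.

Import Order.TTheory GRing.Theory Num.Theory.
Local Open Scope ring_scope.

(** * Rayleigh quotients of real symmetric matrices *)

Section SymmetricMatrix.
Variables (R : realType) (n : nat) (A : 'M[R]_n).
Hypotheses (n_gt0 : (0 < n)%N) (symA : A^T = A).

(** Over the complex numbers [A] is unitarily diagonalisable with real spectrum [d]. In the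
    coordinates [w] of [u] in an eigenbasis both forms become sums of the squared moduli of [w],
    weighted by [d] and by 1, and each [d 0 i] is an eigenvalue of [A]. *)
Lemma rayleigh_mx (u : 'rV[R]_n) :
  (u *m A *m u^T) 0 0 <= lambda1 A * (u *m u^T) 0 0.
Proof.
pose c := real_complex R; pose B := map_mx c A; pose v := map_mx c u.
have realB : B \is a mxOver Num.real.
  by apply/mxOverP => i j; rewrite mxE complex_real.
have symB : B \is symmetricmx.
  by apply/is_hermitianmxP; rewrite expr0 scale1r map_mx_id // map_trmx symA.
have Bspec := orthomx_spectralP (hermitian_normalmx (realsym_hermsym symB realB)).
have Puni := spectral_unitarymx B.
set P := spectralmx B in Bspec Puni; set d := spectral_diag B in Bspec.
rewrite invmx_unitary // in Bspec.
set Ps := map_mx Num.conj P^T in Bspec.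
pose w := v *m Ps.
have ws : map_mx Num.conj w^T = P *m map_mx Num.conj v^T.
  by rewrite /w trmx_mul map_mxM trmxCK.
have vs : map_mx Num.conj v^T = v^T.
  by apply/matrixP => i j; rewrite !mxE; apply/CrealP; rewrite complex_real.
have normE : c ((u *m u^T) 0 0) = \sum_i `|w 0 i| ^+ 2.
  transitivity ((w *m map_mx Num.conj w^T) 0 0); last first.
    by rewrite mxE; apply: eq_bigr => i _; rewrite !mxE normCK.
  rewrite ws /w mulmxA mulmxKtV // vs.
  by rewrite /v map_trmx -map_mxM [RHS]mxE.
have formE : c ((u *m A *m u^T) 0 0) = \sum_i d 0 i * `|w 0 i| ^+ 2.
  transitivity ((w *m diag_mx d *m map_mx Num.conj w^T) 0 0); last first.
    rewrite mxE; apply: eq_bigr => i _.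
    by rewrite mul_mx_diag !mxE mulrAC normCK mulrC.
  rewrite ws /w !mulmxA -[v *m Ps *m _]mulmxA -[v *m (Ps *m _) *m _]mulmxA.
  by rewrite -Bspec vs /v map_trmx -!map_mxM [RHS]mxE.
have d_le i : d 0 i <= c (lambda1 A).
  have Beig : eigenvalue B (d 0 i).
    apply/eigenvalueP; exists (row i P).
      rewrite -row_mul Bspec !mulmxA (unitarymxP Puni) mul1mx.
      by rewrite row_mul row_diag_mx -scalemxAl -rowE.
    apply/eqP => /(congr1 (fun x => x *m Ps)).
    rewrite -row_mul (unitarymxP Puni) mul0mx => /rowP/(_ i).
    by rewrite !mxE eqxx => /eqP; rewrite oner_eq0.
  have /mxOverP/(_ 0 i) := hermitian_spectral_diag_real (realsym_hermsym symB realB).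
  move=> /complex_realP[r dr]; rewrite -/d in dr; rewrite dr.
  rewrite lecR; apply: (proj2 (lambda1_max n_gt0 symA)).
  move: Beig; rewrite dr !eigenvalue_root_char.
  by rewrite -map_char_poly fmorph_root.
suff : c ((u *m A *m u^T) 0 0) <= c (lambda1 A) * c ((u *m u^T) 0 0).
  by rewrite -(rmorphM c) lecR.
rewrite normE formE mulr_sumr.
by apply: ler_sum => i _; rewrite ler_wpM2r ?exprn_ge0.
Qed.

Lemma dotmx_ge0 (u : 'rV[R]_n) : 0 <= (u *m u^T) 0 0.
Proof. by rewrite mxE sumr_ge0 // => i _; rewrite mxE -expr2 sqr_ge0. Qed.

Lemma dotmx_eq0 (u : 'rV[R]_n) : (u *m u^T) 0 0 = 0 -> u = 0.
Proof.
rewrite mxE => /psumr_eq0P u0; apply/rowP => i; rewrite [RHS]mxE; apply/eqP.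
rewrite -sqrf_eq0 expr2; have := u0 _ i isT; rewrite mxE => -> // j _.
by rewrite mxE -expr2 sqr_ge0.
Qed.

(* The form of Q = lambda1 - A is nonnegative and vanishes at u; testing it at
   u - t (u Q) for small t > 0 forces u Q = 0. *)
Lemma rayleigh_mx_eq (u : 'rV[R]_n) :
  (u *m A *m u^T) 0 0 = lambda1 A * (u *m u^T) 0 0 -> u *m A = lambda1 A *: u.
Proof.
move=> uA; pose w := lambda1 A *: u - u *m A.
suff /dotmx_eq0/eqP : (w *m w^T) 0 0 = 0 by rewrite subr_eq0 => /eqP.
set a := (w *m w^T) 0 0.
pose b := lambda1 A * a - (w *m A *m w^T) 0 0.
have trE (x : 'M[R]_1) : x^T 0 0 = x 0 0 by rewrite mxE.
have uAw : (u *m A *m w^T) 0 0 = (w *m A *m u^T) 0 0.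
  by rewrite -[RHS]trE !trmx_mul trmxK symA mulmxA.
have uw : (u *m w^T) 0 0 = (w *m u^T) 0 0.
  by rewrite -[RHS]trE trmx_mul trmxK.
have aE : a = lambda1 A * (u *m w^T) 0 0 - (u *m A *m w^T) 0 0.
  by rewrite /a {1}/w mulmxBl -scalemxAl !mxE.
have ge t : 0 <= t ^+ 2 * b - 2 * t * a.
  have := rayleigh_mx (u - t *: w); rewrite -subr_ge0.
  have -> : (u - t *: w)^T = u^T - t *: w^T by rewrite linearB linearZ.
  rewrite !(mulmxBl, mulmxBr) -!scalemxAl -!scalemxAr.
  rewrite -?scalemxAl.
  have mE (x y : 'M[R]_1) : (x - y) 0 0 = x 0 0 - y 0 0 by rewrite !mxE.
  have sE s (x : 'M[R]_1) : (s *: x) 0 0 = s * x 0 0 by rewrite !mxE.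
  rewrite !(mE, sE) uA -uAw -uw -/a => h.
  suff <- : lambda1 A *
      ((u *m u^T) 0 0 - t * (u *m w^T) 0 0 - (t * (u *m w^T) 0 0 - t * (t * a))) -
      (lambda1 A * (u *m u^T) 0 0 - t * (u *m A *m w^T) 0 0 -
       (t * (u *m A *m w^T) 0 0 - t * (t * (w *m A *m w^T) 0 0)))
    = t ^+ 2 * b - 2 * t * a by [].
  by rewrite /b [in 2 * t * a]aE; ring.
have a_ge0 : 0 <= a := dotmx_ge0 w.
apply/eqP; rewrite eq_le a_ge0 andbT leNgt; apply/negP => a_gt0.
have b_ge0 : 0 <= b by rewrite subr_ge0 rayleigh_mx.
have b1 : 0 < b + 1 by rewrite ltr_wpDl.
(* Any [t > 0] with [t * b < 2 * a] gives a contradiction; dividing by [b + 1] also covers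
   [b = 0]. *)
have := ge (a / (b + 1)).
have -> : (a / (b + 1)) ^+ 2 * b - 2 * (a / (b + 1)) * a =
  - (a ^+ 2 * (b + 2) / (b + 1) ^+ 2).
  by field; rewrite lt0r_neq0.
rewrite oppr_ge0 leNgt divr_gt0 ?exprn_gt0 // mulr_gt0 ?exprn_gt0 //.
by rewrite ltr_wpDl.
Qed.

End SymmetricMatrix.

(** * Spectra of graphs and of their complements *)

Definition adj_form (R : realType) (G : sgraph) (x : G -> R) : R :=
  \sum_u \sum_(v | adj u v) x u * x v.

Section GraphSpectrum.
Variables (R : realType) (G : sgraph).
Hypothesis G_gt0 : (0 < #|G|)%N.
Local Notation A := (adjacency R G).
Implicit Types x y : G -> R.

Let vec x : 'rV[R]_#|G| := \row_i x (enum_val i).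

Let sum_enum (F : G -> R) : \sum_(i < #|G|) F (enum_val i) = \sum_v F v.
Proof. by rewrite -big_enum_val. Qed.

Let vec_adjE x v : (vec x *m A) 0 (enum_rank v) = \sum_(u | adj v u) x u.
Proof.
rewrite mxE (eq_bigr (fun i => x (enum_val i) * (adj v (enum_val i))%:R)).
  rewrite (sum_enum (fun u => x u * (adj v u)%:R)) [RHS]big_mkcond /=.
  by apply: eq_bigr => u _; case: adj; rewrite ?mulr1 ?mulr0.
by move=> i _; rewrite !mxE enum_rankK adj_sym.
Qed.

Let vec_normE x : (vec x *m (vec x)^T) 0 0 = \sum_v x v ^+ 2.
Proof.
by rewrite mxE -sum_enum; apply: eq_bigr => i _; rewrite !mxE expr2.
Qed.

Let vec_formE x : (vec x *m A *m (vec x)^T) 0 0 = adj_form x.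
Proof.
rewrite mxE /adj_form -sum_enum; apply: eq_bigr => i _.
by rewrite -[in LHS](enum_valK i) vec_adjE !mxE enum_rankK mulrC mulr_sumr.
Qed.

Lemma rayleigh x : adj_form x <= lambda1 A * \sum_v x v ^+ 2.
Proof. by rewrite -vec_formE -vec_normE rayleigh_mx // adjacency_tr. Qed.

Lemma rayleigh_eq x : adj_form x = lambda1 A * \sum_v x v ^+ 2 ->
  forall v, \sum_(u | adj v u) x u = lambda1 A * x v.
Proof.
rewrite -vec_formE -vec_normE => /(rayleigh_mx_eq G_gt0 (adjacency_tr _ _)) e v.
by rewrite -vec_adjE e !mxE enum_rankK.
Qed.

Lemma eigen_adj_form x a : (forall v, \sum_(u | adj v u) x u = a * x v) ->
  adj_form x = a * \sum_v x v ^+ 2.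
Proof.
move=> e; rewrite mulr_sumr; apply: eq_bigr => v _.
by rewrite -mulr_sumr e; ring.
Qed.

(** Taking absolute values in an eigenvector keeps the norm and does not decrease the form, so
    equality holds in [rayleigh] and the new vector is again an eigenvector. Strict positivity comes
    later, in [compl_eigen_gt0]. *)
Lemma perron : exists x, [/\ forall v, 0 <= x v, exists v, 0 < x v &
  forall v, \sum_(u | adj v u) x u = lambda1 A * x v].
Proof.
have [/eigenvalueP[w wA w0] _] := lambda1_max G_gt0 (adjacency_tr R G).
pose y v := w 0 (enum_rank v).
have vy : vec y = w by apply/rowP => i; rewrite mxE /y enum_valK.
have ye v : \sum_(u | adj v u) y u = lambda1 A * y v.
  by rewrite -vec_adjE vy wA mxE.
pose x v := `|y v|; exists x.
have [v yv] : exists v, y v != 0.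
  apply/existsP; apply: contraNT w0; rewrite negb_exists => /forallP y0.
  by apply/eqP/rowP => i; have := y0 (enum_val i); rewrite negbK /y enum_valK mxE => /eqP.
split=> [u||]; [exact: normr_ge0 | by exists v; rewrite normr_gt0 |].
apply: rayleigh_eq; apply/eqP; rewrite eq_le rayleigh /=.
rewrite (eq_bigr (fun v => y v ^+ 2)) => [|u _]; last by rewrite real_normK ?num_real.
rewrite -(eigen_adj_form ye); apply: ler_sum => u _; apply: ler_sum => t _.
by rewrite -normrM ler_norm.
Qed.

(** Pair [y] with a Perron vector [x]: by symmetry [lambda1 A * <x, y> = <x, A y> <= m * <x, y>],
    and [<x, y>] is positive. *)
Lemma collatz_wielandt y m : (forall v, 0 < y v) ->
  (forall v, \sum_(u | adj v u) y u <= m * y v) -> lambda1 A <= m.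
Proof.
move=> y_gt0 ym; have [x [x_ge0 [w xw] xe]] := perron.
have xy_gt0 : 0 < \sum_v x v * y v.
  rewrite (bigD1 w) //= ltr_pwDl ?mulr_gt0 // sumr_ge0 // => v _.
  by rewrite mulr_ge0 // ltW.
rewrite -(ler_pM2r xy_gt0) !mulr_sumr.
under eq_bigr do rewrite mulrA -xe mulr_suml big_mkcond /=.
rewrite exchange_big /=; apply: ler_sum => v _; rewrite -big_mkcond /=.
under eq_bigl do rewrite adj_sym.
by rewrite mulrCA -mulr_sumr ler_wpM2l.
Qed.

End GraphSpectrum.

Lemma sum_compl_adj (R : realType) (G : sgraph) (x : G -> R) (v : G) :
  \sum_(u | compl_adj v u) x u = \sum_u x u - x v - \sum_(u | adj v u) x u.
Proof.
suff -> : \sum_u x u = \sum_(u | compl_adj v u) x u +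
    (x v + \sum_(u | adj v u) x u) by rewrite -[RHS]addrA -opprD addrK.
rewrite (bigID (compl_adj v)) /=; congr (_ + _).
rewrite (bigD1 v) /compl_adj ?eqxx //=; congr (_ + _).
by apply: eq_bigl => u; case: (eqVneq v u) => [<-|_]; rewrite ?adj_irr ?negbK ?andbT.
Qed.

Lemma adj_form_compl (R : realType) (G : sgraph) (x : G -> R) :
  @adj_form R (complement G) x =
  (\sum_v x v) ^+ 2 - \sum_v x v ^+ 2 - adj_form x.
Proof.
rewrite expr2 mulr_suml -!sumrB; apply: eq_bigr => u _.
by rewrite -!mulr_sumr (sum_compl_adj x u) !mulrBr expr2.
Qed.

Lemma complement_isomorphic (G H : sgraph) :
  isomorphic G H -> isomorphic (complement G) (complement H).
Proof.
case=> f bf fadj; exists f => // x y /=.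
by rewrite /compl_adj fadj (inj_eq (bij_inj bf)).
Qed.

Lemma isomorphic_card (G H : sgraph) : isomorphic G H -> #|G| = #|H|.
Proof. by case=> f /bij_eq_card. Qed.

Lemma isomorphic_sym (G H : sgraph) : isomorphic G H -> isomorphic H G.
Proof.
case=> f [g fK gK] fadj; exists g; first by exists f.
by move=> x y; rewrite -fadj !gK.
Qed.

(** A Perron vector of [G], pulled back to [H], is a test vector with the same form and norm. *)
Lemma isomorphic_lambda1_le (R : realType) (G H : sgraph) : (0 < #|G|)%N ->
  isomorphic G H -> lambda1 (adjacency R G) <= lambda1 (adjacency R H).
Proof.
move=> G0 isoGH; have H0 : (0 < #|H|)%N by rewrite -(isomorphic_card isoGH).
have [f bf fadj] := isomorphic_sym isoGH.
have [x [x_ge0 [w xw] xe]] := perron R G0.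
have sum_f (P : pred G) (F : G -> R) : \sum_(v | P (f v)) F (f v) = \sum_(v | P v) F v.
  by rewrite [RHS](reindex f) //; exact: onW_bij.
have := rayleigh H0 (x \o f).
have -> : \sum_v (x \o f) v ^+ 2 = \sum_v x v ^+ 2.
  exact: (sum_f predT (fun v => x v ^+ 2)).
have -> : adj_form (x \o f) = adj_form x.
  rewrite /adj_form -(sum_f predT); apply: eq_bigr => u _ /=.
  by rewrite -(sum_f (adj (f u))); apply: eq_bigl => v; rewrite fadj.
rewrite (eigen_adj_form xe) ler_pM2r // (bigD1 w) //=.
by rewrite ltr_pwDl ?exprn_gt0 // sumr_ge0 // => v _; rewrite sqr_ge0.
Qed.

Lemma isomorphic_lambda1 (R : realType) (G H : sgraph) : (0 < #|G|)%N ->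
  isomorphic G H -> lambda1 (adjacency R G) = lambda1 (adjacency R H).
Proof.
move=> G0 isoGH; apply/eqP; rewrite eq_le !isomorphic_lambda1_le //.
  by rewrite -(isomorphic_card isoGH).
exact: isomorphic_sym.
Qed.

(** * Unique simple paths and rooted trees *)

(* Two distinct simple paths with the same ends split at their first step and
   meet again, and the two pieces up to the first meeting point form a cycle. *)
Lemma acyclic_path_inj (G : sgraph) : acyclic G -> forall (p q : seq G) x,
  path adj x p -> uniq (x :: p) -> path adj x q -> uniq (x :: q) ->
  last x p = last x q -> p = q.
Proof.
move=> acG; elim=> [|a p IH] [|b q] x //.
- by move=> _ _ _ /= /andP[xq _] e; rewrite e mem_last in xq.
- by move=> _ /= /andP[xp _] _ _ e; rewrite -e mem_last in xp.
have [<-|ab] := eqVneq a b.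
  move=> /= /andP[_ pp] /andP[_ up] /andP[_ pq] /andP[_ uq] e.
  by congr (_ :: _); apply: IH e.
move=> pp up pq uq e; exfalso.
have meet : has (mem (b :: q)) (a :: p).
  apply/hasP; exists (last a p); first exact: mem_last.
  by rewrite [last a p]e /= mem_last.
(* [w] is the first vertex of [a :: p] that lies on [b :: q]. *)
have [w [p1 [p2 [def_p wq p1q]]]] : exists w p1 p2,
    [/\ a :: p = rcons p1 w ++ p2, w \in b :: q & ~~ has (mem (b :: q)) p1].
  by case/split_find: meet => w p1 p2 wq p1q; exists w, p1, p2.
have [q1 [q2 def_q]] : exists q1 q2, b :: q = rcons q1 w ++ q2.
  by case/path.splitP: wq => q1 q2; exists q1, q2.
rewrite def_p in pp up; rewrite def_q in pq uq p1q.
move: pp pq; rewrite !cat_path => /andP[pp _] /andP[pq _].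
have := acG (x :: rcons p1 w ++ rev q1).
have rq : path adj w (rcons (rev q1) x).
  have := rev_path adj x (rcons q1 w); rewrite last_rcons belast_rcons rev_cons => ->.
  by rewrite (eq_path (e' := adj)) // => ? ?; rewrite adj_sym.
have cyc : cycle adj (x :: rcons p1 w ++ rev q1).
  by rewrite /= rcons_cat cat_path pp last_rcons.
have uc : uniq (x :: rcons p1 w ++ rev q1).
  move: up uq p1q; rewrite /= !mem_cat !cat_uniq !mem_rcons !rcons_uniq !inE !mem_rev rev_uniq.
  rewrite !negb_or => /and4P[/andP[/andP[-> ->] _] /andP[-> ->] _ _].
  move=> /and4P[/andP[/andP[_ ->] _] /andP[wq1 ->] _ _] p1q /=; rewrite andbT.
  apply/hasPn => y; rewrite mem_rev => yq1; rewrite mem_rcons inE negb_or.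
  apply/andP; split; first by apply: contraNneq wq1 => <-.
  apply: contra p1q => yp1; apply/hasP; exists y => //.
  by rewrite /= mem_cat mem_rcons inE yq1 orbT.
rewrite /ucycle cyc uc => /(_ isT) /=.
rewrite size_cat size_rcons size_rev => sz.
(* The cycle has [size p1 + size q1 + 2] vertices and fewer than three, so both pieces are the
   single edge from [x] to [w], and [a = w = b]. *)
have/size0nil p10 : size p1 = 0%N by move: sz; clear; lia.
have/size0nil q10 : size q1 = 0%N by move: sz; clear; lia.
move: def_p def_q; rewrite p10 q10 /= => -[aw _] [bw _].
by rewrite aw bw eqxx in ab.
Qed.

(** A tree as a parent function: the edges join each [v != z] to [par v]. The value [par z] is left
    free, hence the guards. *)
Definition rooted (G : sgraph) (z : G) (par : G -> G) (dep : G -> nat) : Prop :=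
  [/\ dep z = 0%N, forall v, v != z -> dep v = (dep (par v)).+1 &
      forall u v, adj u v = (u != z) && (par u == v) || (v != z) && (par v == u)].

(** The parent of [v] is the second vertex of the unique simple path [P v] from [v] to [z], and the
    depth is the length of that path. *)
Lemma tree_rooted (G : sgraph) (z : G) : is_tree G ->
  exists par dep, rooted z par dep /\ forall v, (dep v < #|G|)%N.
Proof.
move=> [[_ conG] acG].
pose good v p := [&& path adj v p, last v p == z & uniq (v :: p)].
have exP v : exists p, good v p.
  have /connectP[p0 /shortenP[p pp up _] e] := conG v z.
  by exists p; rewrite /good pp -e eqxx up.
pose P v := xchoose (exP v).
have PP v : good v (P v) := xchooseP (exP v).
have PE v q : good v q -> P v = q.
  move=> /and3P[qp /eqP ql uq]; have /and3P[pp /eqP pl up] := PP v.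
  by apply: (acyclic_path_inj acG pp up qp uq); rewrite pl ql.
have Pcons v : v != z -> P v = head z (P v) :: P (head z (P v)) /\ adj v (head z (P v)).
  move=> vz; have := PP v; case: (P v) => [|w p] /=.
    by rewrite /good /= (negPf vz).
  rewrite /good /= => /and3P[/andP[avw pw] e /andP[_ up]]; split=> //.
  by rewrite (PE w p) // /good /= pw e.
exists (fun v => head z (P v)), (fun v => size (P v)); split; last first.
  move=> v; have /and3P[_ _ up] := PP v.
  by have := max_card (mem (v :: P v)); rewrite (card_uniqP up).
split=> [|v vz|u v].
- by rewrite (PE z [::]) // /good /= eqxx.
- by rewrite {1}(proj1 (Pcons v vz)).
apply/idP/idP; last first.
  by case/orP=> /andP[nz /eqP <-]; [|rewrite adj_sym]; apply: (proj2 (Pcons _ nz)).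
move=> auv; have /and3P[pp pl up] := PP u.
have uv : u != v by apply: contraTneq auv => ->; rewrite adj_irr.
(* If [v] lies on [P u], the edge from [u] to [v] shortcuts that path, so by uniqueness [v] is its
   first step. Otherwise [u :: P u] is a simple path from [v], and [u] is the parent of [v]. *)
have [vP|vP] := boolP (v \in P u).
  apply/orP; left; apply/andP; split.
    by apply: contraTneq vP => ->; rewrite (PE z [::]) // /good /= eqxx.
  case/splitPr def_p : _ / vP pp pl up => [p1 p2] pp pl up.
  suff <- : v :: p2 = p1 ++ v :: p2 by rewrite /=.
  rewrite -def_p; apply/esym/PE; rewrite /good /= auv.
  move: pp pl up; rewrite cat_path last_cat /= => /and3P[_ _ ->] -> /=.
  rewrite mem_cat inE !negb_or cat_uniq /= => /andP[/and3P[_ -> ->]].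
  by case/and3P=> _ _ /andP[-> ->].
apply/orP; right; apply/andP; split.
  apply: contraNneq vP => vz; have := mem_last u (P u).
  by rewrite inE (eqP pl) -vz eq_sym (negPf uv).
rewrite (PE v (u :: P u)) //= /good.
by rewrite [path _ _ _]/= adj_sym auv pp /= pl inE negb_or eq_sym uv vP.
Qed.

Section Rooted.
Variables (G : sgraph) (z : G) (par : G -> G) (dep : G -> nat).
Hypothesis rG : rooted z par dep.

Lemma dep_eq0 v : dep v = 0%N -> v = z.
Proof.
by case: rG => _ dS _ d0; apply/eqP/negPn/negP => /dS; rewrite d0.
Qed.

Lemma adj_par v : v != z -> adj v (par v).
Proof. by case: rG => _ _ -> ->; rewrite eqxx. Qed.

(** [adj_form] counts every edge in both orientations. No ordered pair satisfies both disjuncts of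
    adjacency, since each vertex would then be deeper than the other. *)
Lemma rooted_form (R : realType) (x : G -> R) :
  adj_form x = 2 * \sum_(v | v != z) x v * x (par v).
Proof.
have [_ dS adjE] := rG.
have swap : \sum_u \sum_(v | (v != z) && (par v == u)) x u * x v =
            \sum_(v | v != z) x v * x (par v).
  under eq_bigr do rewrite big_mkcondr.
  rewrite exchange_big /=; apply: eq_bigr => v vz.
  rewrite -big_mkcond /=; under eq_bigl do rewrite eq_sym.
  by rewrite big_pred1_eq mulrC.
rewrite mulrDl mul1r -[X in _ + X]swap [X in X + _]big_mkcond -big_split /=.
apply: eq_bigr => u _; rewrite big_mkcond [X in _ + X]big_mkcond /=.
have -> : (if u != z then x u * x (par u) else 0) =
          \sum_v (if (u != z) && (par u == v) then x u * x v else 0).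
  have [uz|uz] := eqVneq u z; first by rewrite big1.
  rewrite -big_mkcond /=; under eq_bigl do rewrite eq_sym.
  by rewrite big_pred1_eq.
rewrite -big_split /=; apply: eq_bigr => v _; rewrite adjE.
case: ifP => [/orP[]|/negbT]; last first.
- by rewrite negb_or => /andP[/negPf-> /negPf->]; rewrite addr0.
- move=> /andP[vz /eqP e]; rewrite vz e eqxx /= ifF ?add0r //.
  by apply/negP => /andP[uz /eqP e']; have := dS _ uz; have := dS _ vz; rewrite e e'; lia.
move=> /andP[uz /eqP e]; rewrite uz e eqxx /= ifF ?addr0 //.
by apply/negP => /andP[vz /eqP e']; have := dS _ uz; have := dS _ vz; rewrite e e'; lia.
Qed.
End Rooted.

(** * An upper bound for the complement of the path *)

Lemma sum_path_adj (R : realType) (n : nat) (F : nat -> R) (i : 'I_n) :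
  \sum_(j | path_adj i j) F j =
  (if (0 < i)%N then F i.-1 else 0) + (if (i.+1 < n)%N then F i.+1 else 0).
Proof.
rewrite (bigID (fun j : 'I_n => j.+1 == i :> nat)) /=; congr (_ + _).
  case: i => -[|i] lt_in /=; first by rewrite big1 // => j /andP[].
  rewrite (eq_bigl (fun j : 'I_n => j == i :> nat)) => [|j]; last first.
    by rewrite /path_adj /= eqSS; case: (j =P i :> nat); rewrite ?orbT ?andbF.
  by rewrite (big_ord1_eq _ F) ltnW.
rewrite (eq_bigl (fun j : 'I_n => j == i.+1 :> nat)) ?(big_ord1_eq _ F) // => j.
rewrite /path_adj [j == _ :> nat]eq_sym.
by case: eqP => [<-|_] /=; [rewrite gtn_eqF // ltnW | rewrite andbN].
Qed.

(* The test vector y_i = 1 + g_i + g_(n+1-i), with g = (-1, a, -b, c, 0, ...)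
   indexed from 0, vanishes at i = 0 and i = n+1, so that both boundary rows
   take the same form as the inner ones. *)
Lemma path_compl_lambda1_le (R : realType) (n : nat) (a b c : R)
    (m := n%:R - 3 + 2 * (a - b + c)) :
  (3 <= n)%N -> 0 <= a -> 0 <= b -> 0 <= c -> b * 2 < 1 ->
  1 + b <= a * (m + 1) -> b * (m + 1) <= a + c -> b <= c * (m + 1) ->
  lambda1 (adjacency R (complement (path_graph n))) <= m.
Proof.
move=> n3 a0 b0 c0 b1 Ha Hb Hc.
pose g k : R := nth 0 [:: -1; a; - b; c] k.
have g_ge k : - b <= g k.+1.
  by case: k => [|[|[|k]]]; rewrite /g /= ?nth_nil; lra.
(* The cases 0, 1, 2 are the three row hypotheses, case 3 is [0 <= c], and the rest is zero. Each
   row inequality for [y] is the sum of two of these, one for each end of the path; the constant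
   terms cancel by the choice of [m]. *)
have Hg k : 0 <= g k + g k.+1 + g k.+2 + m * g k.+1.
  by case: k => [|[|[|[|k]]]]; rewrite /g /= ?nth_nil; lra.
have g_big k : (3 < k)%N -> g k = 0 by move=> k3; rewrite /g nth_default.
pose Y k := 1 + g k + g (n.+1 - k)%N.
pose y (i : path_graph n) := Y i.+1.
have sumg : \sum_(i < n) g i.+1 = a - b + c.
  case: n n3 {m Ha Hb Hc Hg Y y} => [|[|[|k]]] // _.
  by rewrite !big_ord_recl /= big1 => [|i _]; [rewrite /g /=; ring | rewrite g_big].
have sumy : \sum_i y i = n%:R + 2 * (a - b + c).
  rewrite /y /Y !big_split /= sumr_const card_ord sumg -addrA; congr (_ + _).
  suff -> : \sum_(i < n) g (n.+1 - i.+1)%N = a - b + c by ring.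
  rewrite -sumg (reindex_inj rev_ord_inj) /=; apply: eq_bigr => i _.
  by congr g; have := ltn_ord i; lia.
have n_gt0 : (0 < #|complement (path_graph n)|)%N by rewrite card_ord; lia.
apply: (@collatz_wielandt R _ n_gt0 y).
  move=> i; rewrite /y /Y; have := g_ge i.
  have -> : (n.+1 - i.+1 = (n - i).-1.+1)%N by have := ltn_ord i; lia.
  by have := g_ge (n - i).-1; lra.
move=> i; rewrite (sum_compl_adj y i) sumy (sum_path_adj (fun k => Y k.+1)).
have Y0 : Y 0%N = 0 by rewrite /Y subn0 (g_big n.+1) // /g /=; lra.
have Yn : Y n.+1 = 0 by rewrite /Y subnn (g_big n.+1) // /g /=; lra.
have -> : (if (0 < i)%N then Y i.-1.+1 else 0) = Y i.
  by case: posnP => [->|/prednK->].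
have -> : (if (i.+1 < n)%N then Y i.+2 else 0) = Y i.+2.
  by case: ltnP => // le_ni; rewrite -Yn; congr Y; have := ltn_ord i; lia.
have := Hg i; have := Hg (n - i).-1; rewrite /y /Y.
have -> : (n.+1 - i = (n - i).-1.+2)%N by have := ltn_ord i; lia.
have -> : (n.+1 - i.+1 = (n - i).-1.+1)%N by have := ltn_ord i; lia.
have -> : (n.+1 - i.+2 = (n - i).-1)%N by have := ltn_ord i; lia.
have : n%:R + 2 * (a - b + c) = m + 3 by rewrite /m; ring.
by lra.
Qed.

(* The values come from solving the three row inequalities of
   path_compl_lambda1_le approximately, up to terms that are small in 1 / M. *)
Lemma separating_value (R : realType) (M : R) : 3 <= M ->
  exists a b c, let m := M - 1 + 2 * (a - b + c) in
  [/\ 0 <= a, 0 <= b, 0 <= c & b * 2 < 1] /\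
  [/\ 1 + b <= a * (m + 1), b * (m + 1) <= a + c, b <= c * (m + 1)
    & m * (M + 2 + 6 / M + 3 / M ^+ 2) < M ^+ 2 + M + 6 + 6 / M ^+ 2].
Proof.
move=> M3; have M0 : 0 < M by lra.
have M1 : 0 < M ^+ 2 + 1 by rewrite ltr_wpDl ?sqr_ge0.
have M2 : 0 < M ^+ 2 + 2 by rewrite ltr_wpDl ?sqr_ge0.
exists (M * (M ^+ 2 + 3) / ((M ^+ 2 + 1) * (M ^+ 2 + 2))), ((M ^+ 2 + 2)^-1),
  ((M * (M ^+ 2 + 2))^-1).
set a := M * _ / _; set b := _^-1; set c := _^-1 => m.
pose N := M ^+ 4 - M ^+ 3 + 4 * M ^+ 2 - M + 1.
pose D := M * (M ^+ 2 + 1) * (M ^+ 2 + 2).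
(* This is [2 * (a - b + c)] over a common denominator. *)
pose d := 2 * N / D.
have nz : [/\ M != 0, M ^+ 2 + 1 != 0 & M ^+ 2 + 2 != 0] by rewrite !lt0r_neq0.
have [nzM nz1 nz2] := nz.
have D0 : 0 < D by rewrite !mulr_gt0.
have mE : m = M - 1 + d by rewrite /m /d /N /D /a /b /c; field; rewrite nzM nz1 nz2.
(* In powers of [K = M - 3] the polynomials below have only positive coefficients. *)
have [K K0 MK] : exists2 K, 0 <= K & M = K + 3 by exists (M - 3); lra.
have Kp k : 0 <= K ^+ k by rewrite exprn_ge0.
(* The first row inequality reduces to this one: its slack is a positive multiple of [d - M^-1]. *)
have d_ge : M^-1 <= d.
  rewrite -subr_ge0; have -> : d - M^-1 =
     M ^+ 2 * (M ^+ 3 - 2 * M ^+ 2 + 5 * M - 2) / D / M.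
    by rewrite /d /N /D; field; rewrite nzM nz1 nz2.
  rewrite !divr_ge0 ?mulr_ge0 ?sqr_ge0 // ?ltW //.
  have -> : M ^+ 3 - 2 * M ^+ 2 + 5 * M - 2 = K ^+ 3 + 7 * K ^+ 2 + 20 * K + 22.
    by rewrite MK; ring.
  by have := Kp 3%N; have := Kp 2%N; lra.
have d0 : 0 <= d by apply: le_trans d_ge; rewrite invr_ge0 ltW.
rewrite mE; split; split.
- by rewrite divr_ge0 ?mulr_ge0 ?addr_ge0 ?sqr_ge0 // ltW.
- by rewrite invr_ge0 ltW.
- by rewrite invr_ge0 mulr_ge0 // ltW.
- by rewrite mulrC ltr_pdivrMr // mul1r ltrDr exprn_gt0.
- rewrite -subr_ge0; have -> : a * (M - 1 + d + 1) - (1 + b) =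
     (M ^+ 2 + 3) * M * (d - M^-1) / ((M ^+ 2 + 1) * (M ^+ 2 + 2)).
    by rewrite /a /b; field; rewrite nzM nz1 nz2.
  by rewrite divr_ge0 ?mulr_ge0 ?subr_ge0 ?addr_ge0 ?sqr_ge0 // ltW.
- rewrite -subr_ge0; have -> : a + c - b * (M - 1 + d + 1) =
     (M ^+ 4 + 2 * M ^+ 3 - M ^+ 2 + 2 * M) / D / (M ^+ 2 + 2).
    by rewrite /a /b /c /d /N /D; field; rewrite nzM nz1 nz2.
  rewrite !divr_ge0 // ?ltW //.
  have -> : M ^+ 4 + 2 * M ^+ 3 - M ^+ 2 + 2 * M =
    K ^+ 4 + 14 * K ^+ 3 + 71 * K ^+ 2 + 158 * K + 132 by rewrite MK; ring.
  by have := Kp 4%N; have := Kp 3%N; have := Kp 2%N; lra.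
- rewrite -subr_ge0; have -> : c * (M - 1 + d + 1) - b = d / (M * (M ^+ 2 + 2)).
    by rewrite /b /c; field; rewrite nzM nz2.
  by rewrite divr_ge0 // ltW // mulr_gt0.
rewrite -subr_gt0.
have -> : M ^+ 2 + M + 6 + 6 / M ^+ 2 -
    (M - 1 + d) * (M + 2 + 6 / M + 3 / M ^+ 2) =
  (M ^+ 6 - M ^+ 5 + M ^+ 4 - 9 * M ^+ 3 - 10 * M ^+ 2 + 12 * M - 6) / D / M ^+ 2.
  by rewrite /d /N /D; field; rewrite nzM nz1 nz2.
rewrite !divr_gt0 ?exprn_gt0 //.
have -> : M ^+ 6 - M ^+ 5 + M ^+ 4 - 9 * M ^+ 3 - 10 * M ^+ 2 + 12 * M - 6 =
  K ^+ 6 + 17 * K ^+ 5 + 121 * K ^+ 4 + 453 * K ^+ 3 + 908 * K ^+ 2 + 870 * K + 264.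
  by rewrite MK; ring.
by have := Kp 6%N; have := Kp 5%N; have := Kp 4%N; have := Kp 3%N; have := Kp 2%N; lra.
Qed.

(** * Distances, leaves, and the strict left inequality *)

Lemma diameter_leq (G : sgraph) k :
  (forall x y : G, (dist x y <= k)%N) -> (diameter G <= k)%N.
Proof.
by move=> dk; apply/bigmax_leqP => x _; apply/bigmax_leqP => y _.
Qed.

Lemma dist_triangle (G : sgraph) (x y t : G) : connected G ->
  (dist x t <= dist x y + dist y t)%N.
Proof.
move=> [_ conG]; have [p [pp pl <-]] := dist_path (conG x y).
have [q [qp ql <-]] := dist_path (conG y t).
rewrite -size_cat; apply: dist_min; first by rewrite cat_path pp pl.
by rewrite last_cat pl.
Qed.

Lemma dist_adj (G : sgraph) (x y : G) : adj x y -> (dist x y <= 1)%N.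
Proof. by move=> a; apply: (dist_min (p := [:: y])) => //=; rewrite a. Qed.

Lemma dist_refl (G : sgraph) (x : G) : dist x x = 0%N.
Proof. by apply/eqP; rewrite -leqn0; apply: (dist_min (p := [::])). Qed.

Lemma diameter_lt_card (G : sgraph) : connected G -> (diameter G < #|G|)%N.
Proof.
move=> [G0 conG]; rewrite -(prednK G0) ltnS; apply: diameter_leq => x y.
have /connectP[p0 /shortenP[p pp up _] e] := conG x y.
apply: leq_trans (dist_min pp (esym e)) _; rewrite -ltnS prednK //.
by have := max_card (mem (x :: p)); rewrite (card_uniqP up).
Qed.

(* Each level of the rooted tree injects into the previous one, so every level
   has one vertex and the depth is the position on the path. *)
Lemma rooted_inj_path (G : sgraph) (z : G) par dep :
  rooted z par dep -> (forall v, dep v < #|G|)%N ->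
  (forall u v, u != z -> v != z -> par u = par v -> u = v) ->
  isomorphic G (path_graph #|G|).
Proof.
move=> rG dlt par_inj; have [d0 dS adjE] := rG.
have dep_inj : injective dep.
  suff H k u v : dep u = k -> dep v = k -> u = v by move=> u v e; apply: (H (dep v)).
  elim: k u v => [|k IH] u v du dv; first by rewrite (dep_eq0 rG du) (dep_eq0 rG dv).
  have uz : u != z by apply: contra_eq_neq du => ->; rewrite d0.
  have vz : v != z by apply: contra_eq_neq dv => ->; rewrite d0.
  apply: par_inj => //; apply: IH; apply/eqP; rewrite -eqSS -dS ?du ?dv //.
pose f v : path_graph #|G| := Ordinal (dlt v).
have f_inj : injective f by move=> u v /(congr1 val) /dep_inj.
exists f; first by apply: inj_card_bij; rewrite ?card_ord.
have adjP u v : (u != z) && (par u == v) = ((dep v).+1 == dep u).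
  apply/idP/eqP => [/andP[uz /eqP <-]|e]; first by rewrite (dS u).
  have uz : u != z by apply: contra_eq_neq e => ->; rewrite d0.
  by rewrite uz; apply/eqP/dep_inj/eqP; rewrite -eqSS -dS // e.
by move=> u v; rewrite adjE !adjP /= /path_adj /= orbC.
Qed.

(** A vertex of maximal depth has no child, so its parent is its only neighbour. *)
Lemma tree_leaf (G : sgraph) : is_tree G -> (1 < #|G|)%N ->
  exists z c : G, forall v, adj z v = (v == c).
Proof.
move=> tG /card_gt1P[z [y [_ _ zy]]].
have [par [dep [rG _]]] := tree_rooted z tG; have [d0 dS adjE] := rG.
pose t := [arg max_(v > y) dep v].
have tmax v : (dep v <= dep t)%N by rewrite /t; case: arg_maxnP => // w _; apply.
have tz : t != z.
  by apply: contraTneq (tmax y) => ->; rewrite d0 dS // eq_sym.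
exists t, (par t) => v; rewrite adjE tz /= eq_sym orbC.
case: andP => // -[vz /eqP e]; have := tmax v; rewrite (dS v vz) e; lia.
Qed.

(** Root the tree at a leaf [z], with only child [c]. As the tree is not a path, [par] is not
    injective on the [n - 1] other vertices, so its image misses at least two vertices, and these
    are leaves. *)
Lemma tree_three_leaves (G : sgraph) : is_tree G -> (1 < #|G|)%N ->
  ~ isomorphic G (path_graph #|G|) ->
  exists z par dep, rooted z par dep /\ exists c l1 l2 : G,
  [/\ forall v, v != z -> (par v == z) = (v == c),
      forall v, v != z -> par v != l1, forall v, v != z -> par v != l2
    & uniq [:: z; c; l1; l2]].
Proof.
move=> tG G1 niso; have [z [c zc]] := tree_leaf tG G1.
have [par [dep [rG dlt]]] := tree_rooted z tG; have [d0 dS adjE] := rG.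
exists z, par, dep; split=> //; exists c.
have cE v : v != z -> (par v == z) = (v == c).
  by move=> vz; rewrite -zc adjE eqxx vz.
have cz : c != z by have := adj_irr z; rewrite zc eq_sym => ->.
have [u [v [uz vz uv parE]]] : exists u v, [/\ u != z, v != z, u != v & par u = par v].
  apply: contrapT => nex; apply: niso; apply: (rooted_inj_path rG dlt) => u v uz vz e.
  by apply: contrapT => /eqP uv; apply: nex; exists u, v.
pose I := [set par w | w in [set~ z]].
have I_lt : (#|I| < #|[set~ z]|)%N.
  have -> : I = [set par w | w in [set~ z] :\ u].
    apply/setP => y; apply/imsetP/imsetP => -[w]; rewrite !inE => wz ->; last first.
      by exists w; rewrite ?inE //; case/andP: wz.
    have [->|wu] := eqVneq w u; last by exists w; rewrite ?inE ?wu.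
    by exists v; rewrite // !inE vz eq_sym uv.
  apply: leq_ltn_trans (leq_imset_card _ _) _.
  by rewrite [X in (_ < X)%N](cardsD1 u) !inE uz.
have /card_gt1P[l1 [l2 [l1I l2I l12]]] : (1 < #|~: I|)%N.
  by have := cardsC I; have := cardsC1 z; move: I_lt; rewrite -cardsT; lia.
have notI l : l \in ~: I -> forall v, v != z -> par v != l.
  rewrite inE => lI w wz; apply: contraNneq lI => <-.
  by apply: imset_f; rewrite !inE.
have lz l : l \in ~: I -> l != z.
  move=> lI; apply/eqP => e; have := cE c cz.
  by rewrite -e (negPf (notI _ lI _ cz)) eqxx.
(* A childless [c] would be the only vertex besides [z], which rules out that [c] is one of the two
   leaves. *)
have onlyc : (forall v, v != z -> par v != c) -> forall v, v != z -> v = c.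
  move=> cleaf w; elim: {w}(dep w) {-2}w (erefl (dep w)) => [|k IH] w dw wz.
    by rewrite (dep_eq0 rG dw) eqxx in wz.
  apply/eqP; rewrite -cE //; apply/negPn/negP => pz.
  have /IH/(_ pz) e : dep (par w) = k by apply/eqP; rewrite -eqSS -dS ?dw.
  by have := cleaf _ wz; rewrite e eqxx.
have cl l l' : l \in ~: I -> l' \in ~: I -> l != l' -> c != l.
  move=> lI l'I; apply: contraNneq => e; rewrite -e in lI *.
  by rewrite (onlyc (notI _ lI) _ (lz _ l'I)).
exists l1, l2; split=> //; try exact: notI.
rewrite /= !inE !negb_or ![z == _]eq_sym cz (lz l1) // (lz l2) // l12.
by rewrite (cl l1 l2) // (cl l2 l1) // eq_sym.
Qed.

Lemma sum_eq1 (R : realType) (T : finType) (l : T) : \sum_v (v == l)%:R = 1 :> R.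
Proof.
rewrite (bigD1 l) //= eqxx big1 ?addr0 // => v vl.
by rewrite (negPf vl).
Qed.

Lemma tree_compl_rayleigh (R : realType) (G : sgraph) (s : R) (n := #|G|%:R : R) :
  is_tree G -> (1 < #|G|)%N -> ~ isomorphic G (path_graph #|G|) ->
  (n - 1) * (n - 2) + 6 * (n - 2) * s + 6 * s ^+ 2 <=
  lambda1 (adjacency R (complement G)) * (n + 6 * s + 3 * s ^+ 2).
Proof.
move=> tG G1 niso.
have [z [par [dep [rG [c [l1 [l2 [cE p1 p2]]]]]]]] := tree_three_leaves tG G1 niso.
rewrite /= !inE !negb_or andbT => /and3P[/and3P[zc zl1 zl2] /andP[cl1 cl2] l12].
pose x v : R := 1 + s * ((v == z)%:R + (v == l1)%:R + (v == l2)%:R).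
have sum1 : \sum_(v : G) 1 = n :> R by rewrite sumr_const.
have sumx : \sum_v x v = n + 3 * s.
  by rewrite big_split /= sum1 -mulr_sumr !big_split /= !sum_eq1; ring.
have sumx2 : \sum_v x v ^+ 2 = n + 6 * s + 3 * s ^+ 2.
  have x2 v : x v ^+ 2 =
      1 + (2 * s + s ^+ 2) * ((v == z)%:R + (v == l1)%:R + (v == l2)%:R).
    rewrite /x; have [->|vz] := eqVneq v z; first by rewrite (negPf zl1) (negPf zl2) /=; ring.
    have [->|vl1] := eqVneq v l1; first by rewrite (negPf l12) /=; ring.
    by case: (v == l2) => /=; ring.
  under eq_bigr do rewrite x2.
  by rewrite big_split /= sum1 -mulr_sumr !big_split /= !sum_eq1; ring.
have form : adj_form x = 2 * (n - 1 + 3 * s).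
  rewrite (rooted_form rG); congr (_ * _).
  (* The leaf [z] is the parent end of its edge, so its extra weight appears in the term of its
     child [c]. *)
  have pE v : v != z -> x v * x (par v) =
      1 + s * ((v == c)%:R + (v == l1)%:R + (v == l2)%:R).
    move=> vz; rewrite /x cE // (negPf vz) (negPf (p1 v vz)) (negPf (p2 v vz)).
    have [->|vc] := eqVneq v c; first by rewrite (negPf cl1) (negPf cl2) /=; ring.
    by case: (v == l1); case: (v == l2) => /=; ring.
  rewrite (eq_bigr _ pE).
  have := big_split +%R (index_enum G) predT (fun=> 1 : R)
    (fun v => s * ((v == c)%:R + (v == l1)%:R + (v == l2)%:R)).
  rewrite (bigD1 z) //= sum1 -mulr_sumr !big_split /= !sum_eq1.
  rewrite (negPf zc) (negPf zl1) (negPf zl2) /= => e.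
  by apply: (addrI (1 + s * (0 + 0 + 0))); rewrite e; ring.
have G0 : (0 < #|complement G|)%N by apply: ltnW.
have := @rayleigh R (complement G) G0 x.
rewrite sumx2 adj_form_compl sumx sumx2 form; apply: le_trans.
by rewrite le_eqVlt; apply/orP; left; apply/eqP; ring.
Qed.

Lemma path_compl_lambda1_lt (R : realType) (G : sgraph) :
  is_tree G -> (4 < #|G|)%N -> ~ isomorphic G (path_graph #|G|) ->
  lambda1 (adjacency R (complement (path_graph #|G|))) <
  lambda1 (adjacency R (complement G)).
Proof.
move=> tG G4 niso; pose M : R := #|G|%:R - 2.
have nE : #|G|%:R = M + 2 by rewrite /M; ring.
have n5 : 5 <= #|G|%:R :> R by rewrite ler_nat.
have M3 : 3 <= M by rewrite /M; lra.
have M0 : 0 < M by lra.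
have [a [b [c [[a0 b0 c0 b1] [Ha Hb Hc Hm]]]]] := separating_value M3.
set m := M - 1 + _ in Ha Hb Hc Hm.
have mE : #|G|%:R - 3 + 2 * (a - b + c) = m by rewrite nE /m; ring.
apply: (@le_lt_trans _ _ m).
  by rewrite -mE; apply: path_compl_lambda1_le; rewrite ?mE //; lia.
(* With [s = M^-1] and [n = M + 2] both sides become the expressions in the last inequality of
   [separating_value]. *)
have := tree_compl_rayleigh M^-1 tG (ltn_trans _ G4) niso => /(_ isT).
rewrite nE.
have -> : (M + 2 - 1) * (M + 2 - 2) + 6 * (M + 2 - 2) / M + 6 * M^-1 ^+ 2 =
  M ^+ 2 + M + 6 + 6 / M ^+ 2 by field; rewrite lt0r_neq0.
have -> : M + 2 + 6 / M + 3 * M^-1 ^+ 2 = M + 2 + 6 / M + 3 / M ^+ 2.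
  by field; rewrite lt0r_neq0.
move/(lt_le_trans Hm); rewrite ltr_pM2r //.
have : 0 < 6 / M by rewrite divr_gt0.
have : 0 < 3 / M ^+ 2 by rewrite divr_gt0 ?exprn_gt0.
by lra.
Qed.

(** * Positive eigenvectors, brooms, and the strict right inequality *)

(* A zero of x propagates to its neighbours in the complement; if x also had a
   positive entry, every zero would be adjacent in G to every positive entry,
   and G would have diameter at most 2. *)
Lemma compl_eigen_gt0 (R : realType) (G : sgraph) (x : G -> R) (a : R) :
  (2 < diameter G)%N -> (forall v, 0 <= x v) -> (exists w, 0 < x w) ->
  (forall v, \sum_(u | compl_adj v u) x u = a * x v) -> forall v, 0 < x v.
Proof.
move=> diam x0 [w xw] xe v; rewrite lt_def x0 andbT; apply/negP => /eqP xv.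
have cross u t : x u = 0 -> x t != 0 -> adj u t.
  move=> xu; apply: contraNT => nut; have [<-|ut] := eqVneq u t; first exact/eqP.
  apply/eqP; have := xe u; rewrite xu mulr0 => /psumr_eq0P; apply=> //.
  by rewrite /compl_adj ut.
move: diam; rewrite ltnNge => /negP; apply; apply: diameter_leq => p q.
have [xp|xp] := eqVneq (x p) 0; have [xq|xq] := eqVneq (x q) 0.
- apply: (dist_min (p := [:: w; q])) => //=.
  by rewrite [adj w q]adj_sym !cross ?gt_eqF.
- by apply: leq_trans (dist_adj _) _ => //; rewrite cross.
- by apply: leq_trans (dist_adj _) _ => //; rewrite adj_sym cross.
apply: (dist_min (p := [:: v; q])) => //=.
by rewrite [adj p v]adj_sym !cross.
Qed.

Section Broom.
Variables (T : finType) (z b c : T).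
Hypotheses (bz : b != z) (cz : c != z) (bc : b != c).

(** The broom lives on the vertices of the given tree, so that one vector can be tested on both
    graphs. *)
Definition broom_par (v : T) := if v == c then b else z.

Definition broom_adj (u v : T) :=
  (u != z) && (broom_par u == v) || (v != z) && (broom_par v == u).

Fact broom_adj_sym : symmetric broom_adj.
Proof. by move=> u v; rewrite /broom_adj orbC. Qed.

Fact broom_adj_irr : irreflexive broom_adj.
Proof.
move=> u; rewrite /broom_adj orbb /broom_par; case: (eqVneq u c) => [->|_].
  by rewrite (negPf bc) andbF.
by rewrite eq_sym andNb.
Qed.

Definition broom : sgraph := SGraph broom_adj_sym broom_adj_irr.

Lemma broom_rooted :
  @rooted broom z broom_par (fun v => if v == z then 0 else if v == c then 2 else 1)%N.
Proof.
split; rewrite ?eqxx // => v vz; rewrite (negPf vz) /broom_par.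
by case: (v == c); rewrite ?eqxx // (negPf bz) (negPf bc).
Qed.

Lemma broom_adj_root v : broom_adj z v = (v != z) && (v != c).
Proof.
rewrite /broom_adj eqxx /= /broom_par.
by case: (v == c); rewrite /= ?(negPf bz) ?eqxx ?andbF.
Qed.

(** [P_3] goes to [z, b, c] in this order, so its end [ord0], which carries the pendant vertices,
    goes to the centre [z]; the pendant vertices go to the list [r] of all others. *)
Lemma broom_isomorphic : isomorphic (T_1 (#|T| - 3)) broom.
Proof.
pose r := [seq v <- enum T | v \notin [:: z; b; c]].
pose l := [:: z; b; c] ++ r.
have zbc : uniq [:: z; b; c].
  by rewrite /= !inE !negb_or ![z == _]eq_sym bz cz bc.
have ul : uniq l.
  rewrite cat_uniq zbc filter_uniq ?enum_uniq // andbT.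
  by apply/hasPn => v; rewrite mem_filter => /andP[].
have sl : size l = #|T|.
  rewrite -(card_uniqP ul); apply: eq_card => v.
  by rewrite mem_cat mem_filter mem_enum !(inE, andbT) orbN.
have sr : (#|T| - 3 = size r)%N by rewrite -sl size_cat addKn.
pose f (t : T_1 (#|T| - 3)) : broom :=
  match t with inl i => nth z [:: z; b; c] i | inr i => nth z r i end.
have fr i : f (inr i) \notin [:: z; b; c].
  have : f (inr i) \in r by rewrite mem_nth // -sr.
  by rewrite mem_filter => /andP[].
have f_inj : injective f.
  pose idx (t : T_1 (#|T| - 3)) : nat :=
    match t with inl i => i | inr i => (3 + i)%N end.
  have fE t : f t = nth z l (idx t).
    by case: t => [[[|[|[|//]]] ?]|i].
  have szl t : (idx t < size l)%N.
    rewrite size_cat -sr; case: t => i; last by rewrite ltn_add2l ltn_ord.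
    exact: leq_trans (ltn_ord i) (leq_addr _ _).
  move=> t t'; rewrite !fE => /eqP; rewrite nth_uniq //.
  case: t t' => [i|i] [j|j]; rewrite /idx => /eqP e.
  - by congr inl; apply: val_inj.
  - by have := ltn_ord i; rewrite e ltnNge leq_addr.
  - by have := ltn_ord j; rewrite -e ltnNge leq_addr.
  - by congr inr; apply: val_inj; apply: addnI e.
exists f.
  by apply: inj_card_bij => //; rewrite card_sum !card_ord sr -sl size_cat.
have bzF := negPf bz; have czF := negPf cz; have bcF := negPf bc.
have D : (b == z = false) * (c == z = false) * (b == c = false) *
         (z == b = false) * (z == c = false) * (c == b = false).
  by rewrite ![z == _]eq_sym [c == b]eq_sym bzF czF bcF.
have frE (i : 'I_(#|T| - 3)) : let y := nth z r i in (y == z = false) *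
    (y == b = false) * (y == c = false) * (z == y = false) * (b == y = false).
  rewrite /= [z == _]eq_sym [b == _]eq_sym.
  by have := fr i; rewrite !inE !negb_or => /and3P[/negPf-> /negPf-> /negPf->].
case=> [i|i] [j|j]; rewrite [LHS]/= /broom_adj /broom_par.
- by case: i j => [[|[|[|//]]] ?] [[|[|[|//]]] ?] /=; rewrite ?(eqxx, D) /= ?(eqxx, D).
- have := frE j; move: (nth z r j) => y /= yE.
  by case: i => [[|[|[|//]]] ?] /=; rewrite ?(eqxx, D, yE) /= ?(eqxx, D, yE).
- have := frE i; move: (nth z r i) => y /= yE.
  by case: j => [[|[|[|//]]] ?] /=; rewrite ?(eqxx, D, yE) /= ?(eqxx, D, yE).
by rewrite !frE.
Qed.

End Broom.

Lemma compl_lambda1_lt_T_1 (R : realType) (G : sgraph) :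
  is_tree G -> (3 < diameter G)%N ->
  lambda1 (adjacency R (complement G)) <
  lambda1 (adjacency R (complement (T_1 (#|G| - 3)))).
Proof.
move=> tG diam; have conG := proj1 tG; have G0 : (0 < #|G|)%N := proj1 conG.
have diamF k : (k <= 3)%N -> (forall p q : G, dist p q <= k)%N -> False.
  by move=> k3 /diameter_leq; lia.
set lG := lambda1 (adjacency R (complement G)).
have [x [x0 xpos xe]] : exists x : G -> R, [/\ forall v, 0 <= x v,
    exists v, 0 < x v & forall v, \sum_(u | compl_adj v u) x u = lG * x v].
  exact: (@perron R (complement G) G0).
have x_gt0 : forall v, 0 < x v.
  by apply: (@compl_eigen_gt0 R G x lG) => //; apply: ltnW.
have [v0 _] := xpos.
pose z := [arg min_(v < v0) x v]%O.
have zmin v : x z <= x v by rewrite /z; case: arg_minP => // w _; apply.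
have [par [dep [rG _]]] := @tree_rooted G z tG; have [d0 dS adjE] := rG.
have dz (u : G) : adj z u || (u == z) -> (dist u z <= 1)%N /\ (dist z u <= 1)%N.
  case/orP=> [zu|/eqP ->]; last by rewrite dist_refl.
  by split; apply: dist_adj; rewrite // adj_sym.
(* Otherwise every vertex other than [z] is adjacent to [z], and the diameter is at most 2. *)
have [c [cz pcz]] : exists c, c != z /\ par c != z.
  apply: contrapT => nex; apply: (diamF 2%N) => // p q.
  have pz (u : G) : adj z u || (u == z).
    have [|uz] := eqVneq u z; first by rewrite orbT.
    rewrite orbF adjE eqxx uz /=; apply/negPn/negP => puz; apply: nex.
    by exists u.
  have := dist_triangle p z q conG.
  by have [] := dz _ (pz p); have [] := dz _ (pz q); lia.
pose b := par c.
have bc : b != c by apply/eqP => e; have := dS _ cz; rewrite -/b e; lia.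
pose H := broom z bc.
have H0 : (0 < #|complement H|)%N := G0.
rewrite -(isomorphic_lambda1 R H0 (complement_isomorphic (isomorphic_sym
  (broom_isomorphic pcz cz bc)))).
set lH := lambda1 (adjacency R (complement H)).
(* Re-attaching [v] to [z] replaces the factor [x (par v)] by the minimum [x z]; [c] keeps its
   parent [b]. *)
have forms : @adj_form R H x <= @adj_form R G x.
  rewrite (rooted_form (broom_rooted pcz bc)) (rooted_form rG).
  rewrite ler_pM2l //; apply: ler_sum => v _; rewrite ler_wpM2l //.
  by rewrite /broom_par; case: eqVneq => [->|].
have n_gt0 : 0 < \sum_v x v ^+ 2.
  by rewrite (bigD1 z) //= ltr_pwDl ?exprn_gt0 // sumr_ge0 // => v _; rewrite sqr_ge0.
have form_ge : lG * \sum_v x v ^+ 2 <= @adj_form R (complement H) x.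
  by rewrite -(@eigen_adj_form R (complement G) x lG xe) !adj_form_compl lerD2l lerN2.
have form_le := @rayleigh R (complement H) H0 x; rewrite -/lH in form_le.
rewrite ltNge; apply/negP => le_HG.
(* If [lH <= lG], the bounds [form_ge] and [form_le] close up, so [x] attains the maximum for the
   complement of [H] as well. *)
have eHG : lH = lG.
  apply/eqP; rewrite eq_le le_HG -(ler_pM2r n_gt0).
  exact: le_trans form_ge form_le.
have rowH : \sum_(u | @compl_adj H z u) x u = \sum_(u | @compl_adj G z u) x u.
  rewrite [RHS]xe -eHG; apply: (@rayleigh_eq R (complement H) H0 x).
  by apply/eqP; rewrite eq_le form_le -/lH eHG.
have zcN : ~~ adj z c by rewrite adjE eqxx cz (negPf pcz).
have all_adj (u : G) : u != c -> adj z u || (u == z).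
  move=> uc; apply/negPn/negP; rewrite negb_or => /andP[zu uz].
  (* In the complement of [H] the only neighbour of [z] is [c], which is also a neighbour in the
     complement of [G]; a further one [u] would add [x u > 0] to the row. *)
  suff : \sum_(t | @compl_adj H z t) x t < \sum_(t | @compl_adj G z t) x t.
    by rewrite rowH ltxx.
  rewrite (eq_bigl (pred1 c)) => [|t]; last first.
    rewrite /compl_adj /= broom_adj_root // negb_and !negbK eq_sym.
    by case: (eqVneq t z) => [->|] /=; rewrite ?[z == _]eq_sym ?(negPf cz).
  rewrite big_pred1_eq (bigD1 c) /=; last by rewrite /compl_adj eq_sym cz.
  rewrite ltrDl (bigD1 u) /=; last by rewrite /compl_adj eq_sym uz zu.
  by rewrite ltr_pwDl // sumr_ge0.
apply: (diamF 3%N) => // p q.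
have dzc : (dist c z <= 2)%N /\ (dist z c <= 2)%N.
  have cb : adj c b := adj_par rG cz; have bz : adj b z.
    by have := all_adj _ bc; rewrite (negPf pcz) orbF adj_sym.
  split; [apply: (dist_min (p := [:: b; z]))|apply: (dist_min (p := [:: b; c]))];
  by rewrite //= ?cb ?bz // [adj z b]adj_sym [adj b c]adj_sym cb bz.
(* All distances to [z] are at most 1, except 2 for [c]; two distinct vertices are thus within 1 + 2
   of each other. *)
have := dist_triangle p z q conG.
have [->|pc] := eqVneq p c; have [->|qc] := eqVneq q c.
- by rewrite dist_refl.
- by have [] := dz _ (all_adj _ qc); lia.
- by have [] := dz _ (all_adj _ pc); lia.
by have [] := dz _ (all_adj _ pc); have [] := dz _ (all_adj _ qc); lia.
Qed.

Theorem theorem2p5 (R : realType) (n : nat) (T : sgraph) :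
  is_tree T -> #|T| = n -> (3 < diameter T)%N ->
  [/\ lambda1 (adjacency R (complement (path_graph n)))
        <= lambda1 (adjacency R (complement T)),
      lambda1 (adjacency R (complement T))
        <= lambda1 (adjacency R (complement (T_1 (n - 3)))),
      lambda1 (adjacency R (complement (path_graph n)))
        = lambda1 (adjacency R (complement T)) <-> isomorphic T (path_graph n)
    & lambda1 (adjacency R (complement T))
        = lambda1 (adjacency R (complement (T_1 (n - 3))))
      <-> isomorphic T (T_1 (n - 3))].
Proof.
move=> tT <- diam; have T0 : (0 < #|T|)%N by case: tT => -[].
(* Five vertices give [3 <= M = n - 2], the range of [separating_value]. *)
have T4 : (4 < #|T|)%N := leq_ltn_trans diam (diameter_lt_card (proj1 tT)).
have iso_eq (G : sgraph) : isomorphic T G ->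
    lambda1 (adjacency R (complement T)) = lambda1 (adjacency R (complement G)).
  by move=> iso; apply: isomorphic_lambda1 => //; apply: complement_isomorphic.
have right := compl_lambda1_lt_T_1 R tT diam.
have left := path_compl_lambda1_lt R tT T4.
split.
- have [/iso_eq ->//|/left] := EM (isomorphic T (path_graph #|T|)); exact: ltW.
- exact: ltW.
- split=> [e|/iso_eq //]; apply: contrapT => /left; by rewrite e ltxx.
(* Equality contradicts the strict bound [right]; the converse is invariance under isomorphism. *)
split=> [e|/iso_eq //]; by rewrite e ltxx in right.
Qed.
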